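(* There is a universal constant $C>0$ such that for every $n\ge1$, every full rank lattice $\Lambda \subseteq \mathbb{R}^n$ and every convex body $K \subseteq \mathbb{R}^n$ one has $$\mu(\Lambda,K-K) \leq \mu(\Lambda,K) \leq C\log^3(2n) \cdot \mu(\Lambda,K-K).$$
   Context: A lattice is a discrete subgroup of $\mathbb{R}^n$; it has full rank if it spans $\mathbb{R}^n$. A convex body is a compact convex set with non-empty interior. $K-K=\{x-y : x,y\in K\}$ is the difference body. The covering radius is $\mu(\Lambda,K)=\min\{r\ge 0 : \Lambda+rK=\mathrm{span}(\Lambda)\}$. *)

(* Defs.v *)
(* MathComp-Analysis *)
From HB Require Import structures.
From mathcomp Require Import all_boot all_order all_algebra.
From mathcomp Require Import all_classical all_reals all_analysis.

Set Implicit Arguments.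
Unset Strict Implicit.
Unset Printing Implicit Defensive.

Import Order.TTheory GRing.Theory Num.Theory.
Import numFieldNormedType.Exports.

Local Open Scope classical_set_scope.
Local Open Scope ring_scope.

Section Definitions.
Variables (R : realType) (n : nat).
Implicit Types (L K A B : set 'rV[R]_n) (r : R).

Definition lattice L : Prop := zmod_closed (mem L) /\ L `<=` isolated L.

Definition linear_span A : set 'rV[R]_n :=
  [set v | exists2 s : seq 'rV[R]_n, [set` s] `<=` A & v \in << s >>%VS].

Definition full_rank L : Prop := linear_span L = [set: 'rV[R]_n].

Definition convex_body K : Prop := [/\ compact K, convex_set K & K^° !=set0].

Definition minkowski_sum A B : set 'rV[R]_n := [set x + y | x in A & y in B].

Definition dilate r A : set 'rV[R]_n := [set r *: x | x in A].

Definition difference_body K : set 'rV[R]_n := [set x - y | x in K & y in K].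

Definition covering_radii L K : set R :=
  [set r | 0 <= r /\ minkowski_sum L (dilate r K) = linear_span L].

(* The least element of [covering_radii L K]. It exists whenever [L] is a full
   rank lattice and [K] a convex body; where there is no least element, [get]
   returns a default value. *)
Definition covering_radius L K : R :=
  [get r | covering_radii L K r /\ lbound (covering_radii L K) r].

End Definitions.

(* Main.v *)
(* Write l(s) for the logarithm of the reciprocal of the proportion of the torus
   R^n / L that is covered by sK, and suppose that L + (K - K) = R^n. Since
   K + bK = (b + 1)K by convexity, Ruzsa's triangle inequality
   |B| |A - A| <= |A + B|^2 in the torus, for A = K and B = bK, reads
   l(b + 1) <= l(b) / 2. As K - K is covered by n^O(n) translates of K, l(1) is
   O(n log n), so that l(b) < log 2 for some b = O(log n); then bK meets each
   translate of -bK modulo L, that is, L + 2bK = R^n. This gives a factor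
   O(log n), which is O(log^3 (2n)).
   The torus is replaced by the finite group P / L with P = (1/N)L, where N is so
   large that rounding to P moves points by less than the inradius of K; rounding
   costs the passage from K to A = 2K. *)
Require Import Defs.
From HB Require Import structures.
From mathcomp Require Import all_boot all_order all_algebra.
From mathcomp Require Import all_classical all_reals all_analysis.
From mathcomp Require Import perm ring lra zify.

Set Implicit Arguments.
Unset Strict Implicit.
Unset Printing Implicit Defensive.

Import Order.TTheory GRing.Theory Num.Theory.
Import numFieldNormedType.Exports.

Local Open Scope classical_set_scope.
Local Open Scope ring_scope.

(** * Counting classes modulo a subgroup *)

Section ClassCounting.
Variables (V : zmodType) (T : finType) (L P : set V) (f : V -> T).
Hypotheses (LB : forall x y, L x -> L y -> L (x - y)).
Hypotheses (P0 : P 0) (PB : forall x y, P x -> P y -> P (x - y)).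
Hypothesis fP : forall x y, P x -> P y -> f x = f y <-> L (x - y).

(** On [P] the fibres of [f] are the cosets of [L], so for [A] inside [P] this is the image of [A]
    in the finite quotient of [P] by [L]. *)
Definition classes (A : set V) : {set T} :=
  finset (fun t => `[< (f @` A) t >]).

Lemma mem_classes (A : set V) x : A x -> f x \in classes A.
Proof. by move=> Ax; rewrite inE; apply/asboolP; exists x. Qed.

Lemma classesP (A : set V) t : t \in classes A -> exists2 x, A x & f x = t.
Proof. by rewrite inE => /asboolP. Qed.

Lemma classes_select (A : set V) :
  exists g : T -> V, forall t, t \in classes A -> A (g t) /\ f (g t) = t.
Proof.
suff /choice[g gP] : forall t, exists x, t \in classes A -> A x /\ f x = t.
  by exists g.
move=> t; have [/classesP[x Ax fx]|] := boolP (t \in classes A); first by exists x.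
by exists 0.
Qed.

Lemma classesS (A B : set V) : A `<=` B -> classes A \subset classes B.
Proof.
by move=> AB; apply/fintype.subsetP => t /classesP[x /AB Bx <-]; apply: mem_classes.
Qed.

Let PD x y : P x -> P y -> P (x + y).
Proof.
by move=> Px Py; rewrite -[y]opprK; apply: PB => //; rewrite -sub0r; apply: PB.
Qed.

(* Ruzsa's triangle inequality: a class in [B] and a class in [A - A],
   represented by [y] and [x - x'], are recovered from [x + y] and [x' + y]. *)
Lemma ruzsa_triangle (A B : set V) : A `<=` P -> B `<=` P ->
  (#|classes B| * #|classes [set (x - y)%R | x in A & y in A]|
     <= #|classes [set (x + y)%R | x in A & y in B]| ^ 2)%N.
Proof.
move=> AP BP.
set D := [set x - y | x in A & y in A]; set S := [set x + y | x in A & y in B].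
have [g gP] := classes_select B; have [q qP] := classes_select D.
have /choice[h hP] : forall t, exists z : V * V, t \in classes D ->
    [/\ A z.1, A z.2 & f (z.1 - z.2) = t].
  move=> t.
  have [/qP[[x Ax [y Ay xy]] <-]|_] := boolP (t \in classes D); last by exists 0.
  by exists (x, y); split; rewrite //= xy.
pose F (p : T * T) := (f ((h p.2).1 + g p.1), f ((h p.2).2 + g p.1)).
rewrite -mulnn -!cardsX -(@card_in_imset _ _ F); last first.
  move=> [t d] [t' d']; rewrite !finset.in_setX /= => /andP[/gP[Bt ft] /hP[Ad1 Ad2 fd]].
  move=> /andP[/gP[Bt' ft'] /hP[Ad1' Ad2' fd']] [] /fP E1 /fP E2.
  have {}E1 := E1 (PD (AP _ Ad1) (BP _ Bt)) (PD (AP _ Ad1') (BP _ Bt')).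
  have {}E2 := E2 (PD (AP _ Ad2) (BP _ Bt)) (PD (AP _ Ad2') (BP _ Bt')).
  (* Subtracting the two congruences cancels the points of [B]; once [d = d'] is known, the first
     congruence alone gives [t = t']. *)
  have dd : d = d'.
    rewrite -fd -fd'; apply/fP; [by apply: PB; apply: AP..|].
    have := LB E1 E2; congr L.
    have swap (a b y y' : V) : a + y - (b + y') = a - b + (y - y').
      by rewrite opprD addrACA.
    by rewrite swap -opprD !(swap _ _ (g _) (g _)) !subrr !addr0.
  subst d'; congr pair; rewrite -ft -ft'; apply/fP; [exact: BP..|].
  by move: E1; rewrite opprD addrACA subrr add0r.
apply/subset_leq_card/fintype.subsetP => _ /imsetP[[t d] /finset.setXP[/gP[Bt _] /hP[A1 A2 _]] ->].
by rewrite !finset.in_setX; apply/andP; split; apply: mem_classes;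
  [exists (h d).1 | exists (h d).2] => //; exists (g t).
Qed.

(** The class of [u j + a] depends only on [j] and the class of [a]. *)
Lemma classes_cover (J : finType) (u : J -> V) (A : set V) :
  (forall j, P (u j)) -> A `<=` P ->
  (forall x, P x -> exists j, exists2 a, A a & L (x - (u j + a))) ->
  (#|classes P| <= #|J| * #|classes A|)%N.
Proof.
move=> uP AP cov.
have [g gP] := classes_select A.
pose F (p : J * T) := f (u p.1 + g p.2).
rewrite -cardsT -cardsX; apply: leq_trans (leq_imset_card F _).
apply/subset_leq_card/fintype.subsetP => _ /classesP[x Px <-].
have [j [a Aa Lxa]] := cov x Px.
have [Ag fg] := gP _ (mem_classes Aa).
apply/imsetP; exists (j, f a); first by rewrite finset.in_setX finset.in_setT mem_classes.
apply/fP => //; first by apply: PD => //; apply: AP.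
have /fP -/(_ (AP _ Ag) (AP _ Aa)) Lga := fg.
by have := LB Lxa Lga; congr L; rewrite opprB opprD !addrA subrK -addrA -opprD.
Qed.

(** Pigeonhole: [A] and [x - A] have equally many classes, each more than half of all, so they share
    one. *)
Lemma sum_covers (A : set V) x : A `<=` P -> P x ->
  (#|classes P| < 2 * #|classes A|)%N ->
  exists2 a, A a & exists2 b, A b & L (x - (a + b)).
Proof.
move=> AP Px big.
have cardB : #|classes [set x - a | a in A]| = #|classes A|.
  have [g gP] := classes_select A.
  rewrite -(@card_in_imset _ _ (fun t => f (x - g t)) (mem (classes A))); last first.
    move=> t t' /gP[At ft] /gP[At' ft'] /fP E; rewrite -ft -ft'.
    apply/esym/fP; [exact: AP..|].
    have {}E := E (PB Px (AP _ At)) (PB Px (AP _ At')).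
    by move: E; congr L; rewrite opprB [LHS]addrC subrKA.
  apply/eq_card/subset_eqP/andP; split; apply/fintype.subsetP => t.
    move=> /classesP[_ [a Aa <-] <-]; apply/imsetP; exists (f a); first exact: mem_classes.
    have [Ag fg] := gP _ (mem_classes Aa).
    apply/fP; [by apply: PB => //; apply: AP..|].
    have /fP -/(_ (AP _ Ag) (AP _ Aa)) := fg.
    by congr L; rewrite opprB [RHS]addrC subrKA.
  move=> /imsetP[s /gP[As _] ->]; apply: mem_classes.
  by exists (g s).
have [meet0|[t]] := set_0Vmem (classes A :&: classes [set x - a | a in A]).
  have := cardsUI (classes A) (classes [set x - a | a in A]).
  rewrite meet0 cards0 addn0 cardB addnn -mul2n => cardU.
  move: big; rewrite -cardU ltnNge subset_leq_card //.
  rewrite finset.subUset !classesS // => _ [a Aa <-].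
  by apply: PB => //; apply: AP.
rewrite inE => /andP[/classesP[b Ab fb] /classesP[_ [a Aa <-] fa]].
exists b => //; exists a => //; move: fa; rewrite -fb => /fP E.
by have := E (PB Px (AP _ Aa)) (AP _ Ab); congr L; rewrite opprD addrAC addrA.
Qed.
End ClassCounting.

(** * Dilates of a convex set *)

Lemma convex_set_comb (R : numDomainType) (E : lmodType R) (K : set E) x y t :
  convex_set K -> K x -> K y -> 0 <= t -> t <= 1 -> K (t *: x + (1 - t) *: y).
Proof.
move=> cK Kx Ky t0 t1; have := cK x y (Itv01 t0 t1).
by rewrite !inE => /(_ Kx Ky).
Qed.

Section Dilates.
Variables (R : realType) (n : nat) (K : set 'rV[R]_n).
Hypothesis cK : convex_set K.

Lemma dilateD s t x y : 0 <= s -> 0 <= t ->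
  dilate s K x -> dilate t K y -> dilate (s + t) K (x + y).
Proof.
move=> s0 t0 [a Ka <-] [b Kb <-].
have [st0|st0] := eqVneq (s + t) 0.
  have [/eqP -> /eqP ->] : s == 0 /\ t == 0.
    by move: st0 => /eqP; rewrite paddr_eq0// => /andP[].
  by exists a; rewrite // !addr0 !scale0r addr0.
have st : 0 < s + t by rewrite lt_def st0 addr_ge0.
exists (s / (s + t) *: a + (1 - s / (s + t)) *: b).
  apply: convex_set_comb => //; first by rewrite divr_ge0// ltW.
  by rewrite ler_pdivrMr// mul1r lerDl.
rewrite scalerDr !scalerA; congr (_ *: _ + _ *: _); by field.
Qed.

Lemma dilate_le s t x : K 0 -> 0 <= s -> s <= t -> dilate s K x -> dilate t K x.
Proof.
move=> K0 s0 st Kx; rewrite -[t](subrKC s) -[x]addr0.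
by apply: dilateD => //; [rewrite subr_ge0|exists 0; rewrite // scaler0].
Qed.

Lemma dilate1 : dilate 1 K = K.
Proof.
apply/seteqP; split => [_ [x Kx <-]|x Kx]; first by rewrite scale1r.
by exists x; rewrite // scale1r.
Qed.

Lemma simplex_sub (I : finType) (t : I -> R) (w : I -> 'rV[R]_n) :
  K 0 -> (forall i, K (w i)) -> (forall i, 0 <= t i) -> \sum_i t i <= 1 ->
  K (\sum_i t i *: w i).
Proof.
move=> K0 Kw t0 t1; rewrite -dilate1; apply: dilate_le t1 _ => //.
  exact: sumr_ge0.
(* The induction also carries nonnegativity of the partial weights, which [dilateD] requires. *)
apply: (proj2 (A := 0 <= \sum_i t i)).
elim/big_ind2 : _ => [|s x s' x' [s0 sx] [s0' sx']|i _].
- by split => //; exists 0; rewrite // scaler0.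
- by split; [exact: addr_ge0 | exact: dilateD].
- by split => //; exists (w i).
Qed.

End Dilates.

(** * Covering the difference body by translates *)

Section Parallelotope.
Variables (R : realType) (n : nat) (K : set 'rV[R]_n) (r M : R).
Hypotheses (r0 : 0 < r) (ballK : forall x, `|x| <= r -> K x).
Hypothesis KM : forall x, K x -> `|x| <= M.

Lemma ler_mx_norm_entry m p (A : 'M[R]_(m, p)) i j : `|A i j| <= `|A|.
Proof.
rewrite [leRHS]/Num.norm /= mx_normrE.
exact: (le_bigmax 0 (fun ij => `|A ij.1 ij.2|) (i, j)).
Qed.

Lemma mx_norm_le m p (A : 'M[R]_(m, p)) e :
  0 <= e -> (forall i j, `|A i j| <= e) -> `|A| <= e.
Proof.
by move=> e0 Ae; rewrite [leLHS]/Num.norm /= mx_normrE; apply: bigmax_le.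
Qed.

(* Cramer's rule: the coordinates of a point of [K] in a basis of points of [K]
   are ratios of determinants, so they are bounded by [2] as soon as the basis
   maximizes the determinant up to a factor [2]. *)
Lemma near_maximal_basis : exists W : 'M[R]_n,
  [/\ W \in unitmx, forall i, K (row i W) &
      forall x i, K x -> `|(x *m invmx W) 0 i| <= 2].
Proof.
pose D := [set d | exists2 W : 'M[R]_n, (forall i, K (row i W)) & d = `|\det W|].
have detr : D (r ^+ n).
  exists r%:M.
    move=> i; apply: ballK; apply: mx_norm_le; first exact: ltW.
    by move=> j k; rewrite !mxE; case: eqP => _; rewrite ?normr0 ?gtr0_norm// ltW.
  by rewrite det_scalar ger0_norm// exprn_ge0 ?ltW.
have Dub : has_ubound D.
  exists (\sum_(s : 'S_n) \prod_(i < n) M) => _ [W KW ->].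
  apply: le_trans (ler_norm_sum _ _ _) _; apply: ler_sum => s _.
  rewrite normrM normr_sign mul1r normr_prod; apply: ler_prod => i _.
  rewrite normr_ge0 /=; apply: le_trans (KM (KW i)).
  by have := ler_mx_norm_entry (row i W) 0 (s i); rewrite mxE.
have D0 : 0 < sup D by apply: lt_le_trans (ub_le_sup Dub detr); exact: exprn_gt0.
(* The supremum need not be attained; a determinant above half of it suffices and yields the bound
   [2]. *)
have [||_ [W KW ->]] := @sup_adherent _ D (sup D / 2).
- by rewrite divr_gt0.
- by split => //; exists (r ^+ n).
rewrite {1}[sup D]splitr addrK => supW.
have W0 : 0 < `|\det W| by apply: lt_trans supW; rewrite divr_gt0.
have uW : W \in unitmx by rewrite unitmxE unitfE -normr_gt0.
exists W; split => // x i Kx; rewrite /invmx uW -scalemxAr mxE.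
(* [W'] is [W] with row [i] replaced by [x]; its rows lie in [K], so its determinant is at most
   [sup D] in absolute value. *)
pose W' := \matrix_(k, j) (if k == i then x 0 j else W k j).
have -> : (x *m \adj W) 0 i = \det W'.
  rewrite (expand_det_row _ i) mxE; apply: eq_bigr => j _.
  rewrite !mxE eqxx; congr (_ * (_ * \det _)).
  by apply/matrixP => k l; rewrite !mxE eq_sym (negbTE (neq_lift _ _)).
rewrite normrM normfV mulrC ler_pdivrMr//.
have DW' : D `|\det W'|.
  exists W' => // k; have [->|ki] := eqVneq k i.
    by move: Kx; congr (K _); apply/rowP => j; rewrite !mxE eqxx.
  by move: (KW k); congr (K _); apply/rowP => j; rewrite !mxE (negbTE ki).
have := ub_le_sup Dub DW'; lra.
Qed.

Hypothesis cK : convex_set K.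

(* In the coordinates of [near_maximal_basis] the set [K - K] lies in the cube
   of side [8], which is cut into cubes of side [1 / n]; each of these lies in
   a translate of the simplex spanned by the basis, hence of [K]. *)
Lemma difference_body_covering : (0 < n)%N ->
  exists u : {ffun 'I_n -> 'I_(8 * n).+1} -> 'rV[R]_n,
    forall a b, K a -> K b -> exists j, K (a - b - u j).
Proof.
move=> n0; have [W [uW KW Wle2]] := near_maximal_basis.
(* These are the corners of a grid of mesh [1 / n] on [[-4, 4]] in basis coordinates; the endpoint 4
   accounts for the extra index in [(8 * n).+1]. *)
exists (fun j : {ffun 'I_n -> 'I_(8 * n).+1} => \sum_i ((j i)%:R / n%:R - 4) *: row i W) => a b Ka Kb.
pose t := (a - b) *m invmx W.
have tle i : - 4 <= t 0 i <= 4.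
  have := Wle2 a i Ka; have := Wle2 b i Kb.
  by rewrite !ler_norml /t mulmxBl !mxE; lra.
have nR : 0 < n%:R :> R by rewrite ltr0n.
pose s i := n%:R * (t 0 i + 4).
have s0 i : 0 <= s i by have := tle i; rewrite /s => ?; rewrite mulr_ge0 //; lra.
have s8 i : (Num.trunc (s i) < (8 * n).+1)%N.
  rewrite truncn_lt_nat// -natr1 natrM; have := tle i => ?.
  have : s i <= n%:R * 8 by rewrite ler_pM2l//; lra.
  lra.
exists [ffun i => Ordinal (s8 i)].
have -> : a - b = t *m W by rewrite mulmxKV.
rewrite mulmx_sum_row -sumrB.
under eq_bigr do rewrite ffunE /= -scalerBl.
(* The [n] remainders sum to at most 1, as [simplex_sub] requires. *)
have sub i : 0 <= t 0 i - ((Num.trunc (s i))%:R / n%:R - 4) <= n%:R^-1.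
  have /andP[lo hi] := truncn_itv (s0 i).
  have -> : t 0 i = s i / n%:R - 4 by rewrite /s; field; rewrite gt_eqF.
  rewrite opprB addrA subrK -mulrBl; apply/andP; split.
    by rewrite divr_ge0 ?subr_ge0// ltW.
  rewrite -[leRHS]mul1r ler_pM2r ?invr_gt0//; move: hi; rewrite -natr1; lra.
apply: simplex_sub => //.
- by apply: ballK; rewrite normr0 ltW.
- by move=> i; have /andP[] := sub i.
- apply: le_trans (ler_sum _ (G := fun=> n%:R^-1) _) _.
    by move=> i _; have /andP[] := sub i.
  by rewrite sumr_const card_ord -[_^-1 *+ _]mulr_natl divff// gt_eqF.
Qed.

End Parallelotope.

(** * Lattices: closedness, bounded gaps, finite quotients *)

Section Lattices.
Variables (R : realType) (n : nat) (L : set 'rV[R]_n).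
Hypothesis latL : lattice L.

Lemma lattice0 : L 0.
Proof. by have [[/set_mem]] := latL. Qed.

Lemma latticeB x y : L x -> L y -> L (x - y).
Proof.
by move=> Lx Ly; have [[_ LB] _] := latL; apply/set_mem/LB; apply/mem_set.
Qed.

Lemma latticeD x y : L x -> L y -> L (x + y).
Proof.
move=> Lx Ly; rewrite -[y]opprK; apply: latticeB => //.
by rewrite -sub0r; apply: latticeB => //; exact: lattice0.
Qed.

Lemma latticeMn x k : L x -> L (x *+ k).
Proof.
by move=> Lx; elim: k => [|k IH]; [exact: lattice0 | rewrite mulrS; exact: latticeD].
Qed.

Lemma latticeMz x z : L x -> L (z%:~R *: x).
Proof.
move=> Lx; rewrite scaler_int; case: z => k; first exact: latticeMn.
by rewrite NegzE mulrNz -sub0r; apply: latticeB; [exact: lattice0 | exact: latticeMn].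
Qed.

Lemma lattice_isolated0 : exists2 e : R, 0 < e & forall x, L x -> `|x| < e -> x = 0.
Proof.
have [_ /(_ _ lattice0)[_ [U /nbhs_ballP[e /= e0 eU] UL]]] := latL.
exists e => // x Lx xe; have : (U `&` L) x.
  by split => //; apply: eU; rewrite -ball_normE /ball_ /= sub0r normrN.
by rewrite UL.
Qed.

(** Lattice points closer than [e] coincide, so only one lies within [e / 2] of a limit point, which
    must then equal it. *)
Lemma lattice_closed : closed L.
Proof.
have [e e0 Le] := lattice_isolated0 => x Lx.
have near_x d : 0 < d -> exists2 y, L y & `|x - y| < d.
  move=> d0; have [y [Ly xy]] := Lx _ (nbhsx_ballx x _ d0); exists y => //.
  by move: xy; rewrite -ball_normE.
have [y Ly xy] := near_x (e / 2) (divr_gt0 e0 (ltr0n _ 2)).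
have [<-//|xNy] := eqVneq y x.
have d0 : 0 < `|x - y| by rewrite normr_gt0 subr_eq0 eq_sym.
have [z Lz xz] := near_x _ d0.
have yz : y - z = 0.
  apply: Le; first exact: latticeB.
  have := ler_distD x y z; rewrite (distrC y x); lra.
by move: xz; rewrite -(subr0_eq yz) ltxx.
Qed.

(** The property [bdd], that all multiples of [x] stay at bounded distance from [L], holds on [L]
    and survives sums and scaling. Full rank extends it to all vectors, and the standard basis then
    gives a uniform bound. *)
Lemma lattice_cobounded : full_rank L ->
  exists2 M : R, 0 <= M & forall x, exists2 l, L l & `|x - l| <= M.
Proof.
move=> fullL.
pose bdd (x : 'rV[R]_n) := exists M : R, forall t, exists2 l, L l & `|t *: x - l| <= M.
have bdd0 : bdd 0.
  exists 0 => t; exists 0; first exact: lattice0.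
  by rewrite scaler0 subr0 normr0.
have bddD x y : bdd x -> bdd y -> bdd (x + y).
  move=> [M xM] [N yN]; exists (M + N) => t.
  have [l Ll xl] := xM t; have [l' Ll' yl'] := yN t.
  exists (l + l'); first exact: latticeD.
  by rewrite scalerDr opprD addrACA (le_trans (ler_normD _ _))// lerD.
have bddZ a x : bdd x -> bdd (a *: x).
  by move=> [M xM]; exists M => t; rewrite scalerA; exact: xM.
have bddL x : L x -> bdd x.
  move=> Lx; exists `|x| => t; exists ((Num.floor t)%:~R *: x); first exact: latticeMz.
  rewrite -scalerBl normrZ ler_piMl// ger0_norm ?subr_ge0 ?floor_le//.
  by have := floorD1_gt t; rewrite intrD; lra.
have bddT x : bdd x.
  have [s sL xs] : linear_span L x by rewrite fullL.
  rewrite (coord_span (X := in_tuple s) xs); elim/big_ind : _ => // i _.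
  by apply/bddZ/bddL/sL => /=; exact: mem_nth.
have /choice[M HM] := fun i : 'I_n => bddT (delta_mx 0 i).
exists (\sum_i `|M i|); first exact: sumr_ge0.
move=> x; have /choice[l Hl] : forall i, exists l, L l /\ `|x 0 i *: delta_mx 0 i - l| <= M i.
  by move=> i; have [l Ll xl] := HM i (x 0 i); exists l.
exists (\sum_i l i).
  by elim/big_ind : _ => [||i _]; [exact: lattice0 | exact: latticeD | have [] := Hl i].
rewrite {1}(row_sum_delta x) -sumrB.
apply: le_trans (ler_norm_sum _ _ _) _; apply: ler_sum => i _.
by have [_ /le_trans] := Hl i; apply; exact: ler_norm.
Qed.

(** Each coset of [L] has a representative of norm at most [M]. Cells of side [h] separate those
    that arise here: [N] times a difference within one cell lies in [L] and has norm at most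
    [e / 2], so it vanishes. *)
Lemma refined_lattice_classes (N : nat) : (0 < N)%N -> full_rank L ->
  exists (T : finType) (f : 'rV[R]_n -> T), forall x y,
    L (N%:R *: x) -> L (N%:R *: y) -> f x = f y <-> L (x - y).
Proof.
move=> N0 fullL; have [M M0 LM] := lattice_cobounded fullL.
have [e e0 Le] := lattice_isolated0.
have NR : 0 < N%:R :> R by rewrite ltr0n.
pose h : R := e / (2 * N%:R).
have h0 : 0 < h by rewrite divr_gt0// mulr_gt0.
pose cell (y : 'rV[R]_n) : {ffun 'I_n -> 'I_(Num.trunc (2 * M / h)).+1} :=
  [ffun i => inord (Num.trunc ((y 0 i + M) / h))].
pose rep x := xget 0 [set y | L (x - y) /\ `|y| <= M].
have repP x : L (x - rep x) /\ `|rep x| <= M.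
  apply: (@xgetPex _ 0 [set y | L (x - y) /\ `|y| <= M]).
  by have [l Ll xl] := LM x; exists (x - l); rewrite /= opprB addrC subrK.
have near_cell y z : `|y| <= M -> `|z| <= M -> cell y = cell z -> `|y - z| <= h.
  move=> yM zM /ffunP yz; apply: mx_norm_le => [|i j]; first exact: ltW.
  have itv (v : 'rV[R]_n) : `|v| <= M -> 0 <= (v 0 j + M) / h <= 2 * M / h.
    move=> /(le_trans (ler_mx_norm_entry v 0 j)); rewrite ler_norml => /andP[? ?].
    by rewrite divr_ge0 ?(ltW h0)//= ?ler_pM2r ?invr_gt0//; lra.
  have trunc_lt (v : 'rV[R]_n) : `|v| <= M ->
      (Num.trunc ((v 0 j + M) / h)%R < (Num.trunc (2 * M / h)%R).+1)%N.
    move=> /itv /andP[v0 vM]; rewrite truncn_lt_nat//; apply: le_lt_trans vM _.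
    exact: truncnS_gt.
  have := yz j; rewrite !ffunE => /(congr1 val) /=; rewrite !inordK ?trunc_lt// => E.
  have /andP[/truncn_itv/andP[y1 y2] _] := itv y yM.
  have /andP[/truncn_itv/andP[z1 z2] _] := itv z zM.
  rewrite ord1 !mxE ler_norml; move: y1 y2 z1 z2; rewrite E -natr1.
  rewrite ler_pdivlMr// ltr_pdivrMr// ler_pdivlMr// ltr_pdivrMr//.
  by move: (Num.trunc _)%:R => q; lra.
exists _, (cell \o rep) => x y Px Py; split => [/= xy|Lxy]; last first.
  (* [rep] chooses from a set that depends only on the coset, so congruent points get the same
     representative. *)
  rewrite /= /rep; congr (cell (xget 0 _)); apply/seteqP.
  split => z /= [Lz zM]; split => //.
    by have := latticeB Lz Lxy; congr L; rewrite opprB [LHS]addrC subrKA.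
  by rewrite -(subrKA y); apply: latticeD.
have [[Lx xM] [Ly yM]] := (repP x, repP y).
have LN z : L z -> L (N%:R *: z) by move=> Lz; rewrite scaler_nat; exact: latticeMn.
have : N%:R *: (rep x - rep y) = 0.
  apply: Le.
    have -> : rep x - rep y = x - y - ((x - rep x) - (y - rep y)).
      rewrite (_ : x - rep x - _ = x - y - (rep x - rep y)) ?subKr//.
      by rewrite !opprD !opprK addrACA.
    rewrite scalerBr (scalerBr _ x y); apply: latticeB; first exact: latticeB.
    by apply: LN; exact: latticeB.
  rewrite normrZ gtr0_norm//; apply: (@le_lt_trans _ _ (N%:R * h)).
    by rewrite ler_pM2l//; exact: near_cell.
  have -> : N%:R * h = e / 2 by rewrite /h; field; rewrite gt_eqF.
  lra.
move=> /eqP; rewrite scaler_eq0 gt_eqF//= => /eqP /subr0_eq rxy.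
by rewrite -(subrKA (rep x)) [X in _ + (X - _)]rxy -(opprB y); apply: latticeB.
Qed.

End Lattices.

(** * The Ruzsa iteration in the finite quotient *)

(** The left side is the number of translates of [K] used to cover its difference body; the bound
    follows from [8 * n + 1 < 16 ^ n]. *)
Lemma exp_8n1_lt n : (0 < n)%N -> ((8 * n).+1 ^ n < 2 ^ (4 * n ^ 2))%N.
Proof.
move=> n0; have lt16 : ((8 * n).+1 < 2 ^ (4 * n))%N.
  by rewrite expnM; elim: n n0 => // -[//|n] IH _; rewrite expnS; have := IH isT; lia.
by rewrite -mulnn mulnA expnM ltn_exp2r.
Qed.

(** [S b] discretizes the dilate of [K] by [b]. After [k] Ruzsa steps from [S 2], the set
    [S (2 + 2 * k)] has more than half of all classes. Two summands from it and one copy of [K] for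
    rounding [x] make up the factor [4 * k + 5]. *)
Lemma sum_dilate_covers (R : realType) (n k : nat) (L K : set 'rV[R]_n) (r M : R) :
  (0 < n)%N -> lattice L -> full_rank L -> convex_set K ->
  0 < r -> (forall x, `|x| <= r -> K x) -> (forall x, K x -> `|x| <= M) ->
  (forall x, exists a b, [/\ K a, K b & L (x - (a - b))]) ->
  (4 * n ^ 2 <= 2 ^ k)%N ->
  forall x, exists2 y, dilate (4 * k + 5)%:R K y & L (x - y).
Proof.
move=> n0 latL fullL cK r0 rK KM cov kn.
have [M0 M0ge0 LM0] := lattice_cobounded latL fullL.
pose N := (Num.trunc (M0 / r)).+1.
have NR : 0 < N%:R :> R by rewrite ltr0n.
have MN : M0 / N%:R <= r.
  by rewrite ler_pdivrMr// mulrC -ler_pdivrMr// ltW// truncnS_gt.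
have [T [f fP]] := refined_lattice_classes latL (ltn0Sn _ : (0 < N)%N) fullL.
pose P := [set x | L (N%:R *: x)].
have LB := latticeB latL.
have PB x y : P x -> P y -> P (x - y).
  by rewrite /P /= => Px Py; rewrite scalerBr; exact: LB.
have LP x : L x -> P x by move=> Lx; rewrite /P /= scaler_nat; exact: latticeMn.
have P0 : P 0 by apply/LP; exact: lattice0.
have PD x y : P x -> P y -> P (x + y).
  by move=> Px Py; rewrite -[y]opprK -[- y]sub0r; apply: (PB) => //; exact: PB.
have K0 : K 0 by apply: rK; rewrite normr0 ltW.
have approx x : exists p, P p /\ `|x - p| <= r.
  have [l Ll xl] := LM0 (N%:R *: x); exists (N%:R^-1 *: l); split.
    by rewrite /P /= scalerA divff ?gt_eqF// scale1r.
  have -> : x - N%:R^-1 *: l = N%:R^-1 *: (N%:R *: x - l).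
    by rewrite scalerBr scalerA mulVf ?gt_eqF// scale1r.
  rewrite normrZ gtr0_norm ?invr_gt0// mulrC; apply: le_trans MN.
  by rewrite ler_pM2r ?invr_gt0.
pose S (b : nat) := P `&` dilate b%:R K.
have SP b : S b `<=` P by move=> x [].
have S2 x e : K x -> `|e| <= r -> dilate 2%:R K (x + e).
  move=> Kx er; rewrite -[2%:R]/(1 + 1); apply: (dilateD cK) => //.
    by exists x; rewrite // scale1r.
  by exists e; rewrite ?scale1r//; exact: rK.
pose c b := #|classes f (S b)|; pose g := #|classes f P|.
(* Modulo [L] every point lies in the difference body, hence in some [u j + K]; rounding [u j] to
   [v j] in [P] enlarges [K] to its double. *)
have start : (g <= (8 * n).+1 ^ n * c 2)%N.
  have [u uP] := difference_body_covering r0 rK KM cK n0.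
  have /choice[v vP] := fun j => approx (u j).
  have := @classes_cover _ T L P f LB P0 PB fP _ v (S 2).
  rewrite card_ffun !card_ord; apply => // [j|x Px]; first by have [] := vP j.
  have [a [b [Ka Kb Lxab]]] := cov x; have [j Kj] := uP a b Ka Kb.
  have [Pv ve] := vP j; exists j, (a - b - v j); last by rewrite subrKC.
  split; last by rewrite -(subrKA (u j)); exact: S2.
  apply: (PB) => //; rewrite -[a - b](subKr x); apply: PB => //.
  exact: LP.
have step b : (c b * g <= c (b + 2)%N ^ 2)%N.
  have := ruzsa_triangle LB P0 PB fP (SP 2) (SP b).
  (* Differences of [S 2] meet every class: [a] is rounded to [p] and [b'] is moved by the same
     vector, so the difference stays exactly [a - b']. *)
  have gD : (g <= #|classes f (difference_body (S 2))|)%N.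
    apply/subset_leq_card/fintype.subsetP => _ /classesP[x Px <-].
    have [a [b' [Ka Kb Lxab]]] := cov x; have [p [Pp pa]] := approx a.
    have Pab : P (a - b') by rewrite -[a - b'](subKr x); apply: (PB) => //; exact: LP.
    have -> : f x = f (a - b') by apply/fP.
    apply: mem_classes; exists p.
      by split=> //; rewrite -[p](subrKC a); apply: S2 => //; rewrite distrC.
    exists (p - (a - b')); last by rewrite subKr.
    split; first exact: PB.
    have -> : p - (a - b') = b' + (p - a) by rewrite opprB addrCA.
    by apply: S2 => //; rewrite distrC.
  move=> ruzsa; apply: leq_trans (leq_mul (leqnn _) gD) _.
  apply: leq_trans ruzsa _; rewrite leq_sqr.
  apply/subset_leq_card/classesS => _ [x [Px Kx] [y [Py Ky] <-]].
  by split; [exact: PD | rewrite addnC natrD; exact: dilateD].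
have iter j : (g ^ (2 ^ j) <= (8 * n).+1 ^ n * c (2 + 2 * j)%N ^ (2 ^ j))%N.
  elim: j => [|j IH]; first by rewrite !expn1.
  (* One factor [g ^ (2 ^ j)] is bounded by induction, the other is absorbed by [step] raised to the
     power [2 ^ j]. *)
  rewrite expnSr expnM -mulnn.
  apply: leq_trans (leq_mul IH (leqnn _)) _; rewrite -mulnA leq_mul2l.
  apply/orP; right; rewrite -expnMn [(2 ^ j * 2)%N]mulnC expnM leq_exp2r ?expn_gt0//.
  by have := step (2 + 2 * j)%N; congr (_ <= c _ ^ 2)%N; lia.
move=> x; have [p [Pp xp]] := approx x.
pose b := (2 + 2 * k)%N.
have cb : (0 < c b)%N.
  apply/card_gt0P; exists (f 0); apply: mem_classes; split => //.
  by exists 0; rewrite // scaler0.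
have big : (g < 2 * c b)%N.
  (* Otherwise cancelling the power of [c b] leaves [2 ^ (2 ^ k) <= (8 * n).+1 ^ n], against
     [exp_8n1_lt]. *)
  rewrite ltnNge; apply/negP => cg.
  have := leq_trans (_ : ((2 * c b) ^ (2 ^ k) <= _)%N) (iter k).
  rewrite leq_exp2r ?expn_gt0// => /(_ cg).
  rewrite expnMn leq_pmul2r ?expn_gt0 ?cb// leqNgt.
  by rewrite (leq_trans (exp_8n1_lt n0))// leq_exp2l.
have [s [_ Ks] [t [_ Kt] Lpst]] := sum_covers PB fP (SP b) Pp big.
exists (x - p + (s + t)); last by rewrite opprD addrA subKr.
have -> : (4 * k + 5)%:R = 1 + (b%:R + b%:R) :> R.
  by rewrite -natrD nat1r; congr (_%:R); rewrite /b; lia.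
apply: (dilateD cK) => //.
  by rewrite dilate1; exact: rK.
exact: dilateD.
Qed.

(** * Convex bodies and their difference bodies *)

Section ConvexBodies.
Variables (R : realType) (n : nat) (K : set 'rV[R]_n).
Hypothesis bodyK : convex_body K.

Lemma convex_body_bounded : exists M, forall x, K x -> `|x| <= M.
Proof.
have [/compact_bounded[M [_ KM]] _ _] := bodyK; exists (M + 1) => x Kx.
by apply: KM Kx; rewrite ltrDl.
Qed.

Lemma convex_body_ball : exists c r, [/\ 0 < r, K c & forall x, `|x| <= r -> K (c + x)].
Proof.
have [_ _ [c /nbhs_ballP[r /= r0 rK]]] := bodyK; exists c, (r / 2); split.
- by rewrite divr_gt0.
- exact/rK/ballxx.
- move=> x xr; apply: rK; rewrite -ball_normE /ball_ /= opprD addrA subrr sub0r normrN.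
  by apply: le_lt_trans xr _; rewrite ltr_pdivrMr// ltr_pMr// ltr1n.
Qed.

Lemma convex_body_difference : convex_body (difference_body K).
Proof.
have [compK convK _] := bodyK; split.
- have -> : difference_body K = (fun z => z.1 - z.2) @` (K `*` K).
    apply/seteqP; split => [_ [x Kx [y Ky <-]]|_ [[x y] [Kx Ky] <-]].
      by exists (x, y).
    by exists x => //; exists y.
  apply: continuous_compact; last exact: compact_setX.
  apply: continuous_subspaceT; exact: sub_continuous.
- move=> x y t; rewrite !inE => -[a Ka [b Kb <-]] [a' Ka' [b' Kb' <-]].
  have := convK a a' t; have := convK b b' t; rewrite !inE => /(_ Kb Kb') Kbb /(_ Ka Ka') Kaa.
  exists (conv t (a : convex_lmodType _) a') => //.
  exists (conv t (b : convex_lmodType _) b') => //.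
  by rewrite /conv /= !scalerBr opprD addrACA.
- have [c [r [r0 Kc rK]]] := convex_body_ball.
  exists 0; apply/nbhs_ballP; exists r => //= x.
  rewrite -ball_normE /ball_ /= sub0r normrN => /ltW /rK Kcx.
  by exists (c + x) => //; exists c; rewrite // addrC addKr.
Qed.

End ConvexBodies.

(** * Covering radii and their minimum *)

Section CoveringRadius.
Variables (R : realType) (n : nat) (L : set 'rV[R]_n).
Hypotheses (latL : lattice L) (fullL : full_rank L).

Lemma covering_radiiP (K : set 'rV[R]_n) r : covering_radii L K r <->
  0 <= r /\ forall x, exists2 k, K k & L (x - r *: k).
Proof.
rewrite /covering_radii /= fullL; split=> -[r0 cov]; split => //.
  move=> x; have : minkowski_sum L (dilate r K) x by rewrite cov.
  by move=> [l Ll [_ [k Kk <-] <-]]; exists k; rewrite // addrK.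
apply/seteqP; split => // x _; have [k Kk Lxk] := cov x.
by exists (x - r *: k) => //; exists (r *: k); [exists k|rewrite subrK].
Qed.

Variable K : set 'rV[R]_n.
Hypothesis bodyK : convex_body K.

Lemma covering_radii_nonempty : covering_radii L K !=set0.
Proof.
have [c [r [r0 Kc rK]]] := convex_body_ball bodyK.
have [M M0 LM] := lattice_cobounded latL fullL.
(* The ball in [K], scaled by [s], has radius [M + 1]; the summand 1 keeps [s] positive. *)
pose s := (M + 1) / r; have s0 : 0 < s by rewrite divr_gt0// ltr_wpDl.
exists s; apply/covering_radiiP; split; first exact: ltW.
move=> x; have [l Ll xl] := LM (x - s *: c).
exists (c + s^-1 *: (x - s *: c - l)).
  apply: rK; rewrite normrZ gtr0_norm ?invr_gt0// ler_pdivrMl//.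
  by rewrite /s divfK ?gt_eqF//; lra.
by rewrite scalerDr scalerA divff ?gt_eqF// scale1r opprD addrA subKr.
Qed.

(** [K] may miss the origin, but for [c] in [K] the dilate by [s] contains the dilate by [r]
    translated by [(s - r) *: c], and translations preserve covering. *)
Lemma covering_radii_le r s : covering_radii L K r -> r <= s -> covering_radii L K s.
Proof.
move=> /covering_radiiP[r0 cov] rs; apply/covering_radiiP.
split; first exact: le_trans rs.
have [c [_ [_ Kc _]]] := convex_body_ball bodyK; have [_ cK _] := bodyK.
move=> x; have [k Kk Lk] := cov (x - (s - r) *: c).
have : dilate (r + (s - r)) K (r *: k + (s - r) *: c).
  by apply: dilateD; rewrite ?subr_ge0//; [exists k|exists c].
rewrite subrKC => -[y Ky yE]; exists y => //.
by rewrite yE opprD addrA addrAC.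
Qed.

(** For fixed [x], the pairs [(t, k)] with [t] in [[s, s + 1]], [k] in [K] and [x - t *: k] in [L]
    form a compact set. Its projection to [t] is closed and contains all radii just above [s], hence
    [s]. *)
Lemma covering_radii_inf : covering_radii L K (inf (covering_radii L K)).
Proof.
set s := inf _.
have lb0 : lbound (covering_radii L K) 0 by move=> r [].
have hasinf : has_inf (covering_radii L K).
  by split; [exact: covering_radii_nonempty | exists 0].
have s0 : 0 <= s by apply: lb_le_inf => //; exact: covering_radii_nonempty.
have above r : s < r -> covering_radii L K r.
  rewrite -subr_gt0 => rs; have [e Ke er] := inf_adherent rs hasinf.
  by apply: covering_radii_le Ke _; move: er; rewrite -/s subrKC => /ltW.
apply/covering_radiiP; split => // x.
pose E := (`[s, s + 1] `*` K) `&` [set z : R^o * 'rV[R]_n | L (x - z.1 *: z.2)].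
have compE : compact E.
  apply: compact_closedI.
    by apply: compact_setX; [exact: segment_compact | case: bodyK].
  apply: (@preimage_closed _ _ (fun z : R^o * 'rV[R]_n => x - z.1 *: z.2)).
    move=> z _; apply: cvgB; first exact: cvg_cst.
    exact: scale_continuous.
  exact: lattice_closed.
have : closed (fst @` E).
  apply: compact_closed; first exact: (@norm_hausdorff _ R^o).
  apply: continuous_compact compE; apply: continuous_subspaceT => z; exact: cvg_fst.
move=> /(_ s)[|[t k] [[_ Kk] /= Lk] /= ts]; last by exists k; rewrite // -ts.
move=> U /nbhs_ballP[e /= e0 eU]; pose d := Num.min (e / 2) 1.
have d0 : 0 < d by rewrite lt_min divr_gt0//=.
have sd : s < s + d by rewrite ltrDl.
have /covering_radiiP[_ /(_ x)[k Kk Lk]] := above _ sd.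
exists (s + d); split.
  exists (s + d, k) => //; split => //; split => //=.
  by rewrite in_itv /= ltW//= lerD2l ge_min lexx orbT.
apply: eU; rewrite -ball_normE /ball_ /= opprD addrA subrr sub0r normrN gtr0_norm//.
by rewrite gt_min ltr_pdivrMr// ltr_pMr// ltr1n.
Qed.

(** The infimum is a least element, so [get] does not return its default. *)
Lemma covering_radius_least : covering_radii L K (covering_radius L K) /\
  lbound (covering_radii L K) (covering_radius L K).
Proof.
apply: (@getPex R [set r | covering_radii L K r /\ lbound (covering_radii L K) r]).
exists (inf (covering_radii L K)); split; first exact: covering_radii_inf.
by apply: ge_inf; exists 0 => r [].
Qed.

(** For [c] in [K], the translate [K - c] lies in the difference body. *)
Lemma covering_radii_difference r :
  covering_radii L K r -> covering_radii L (difference_body K) r.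
Proof.
move=> /covering_radiiP[r0 cov]; apply/covering_radiiP; split => // x.
have [c [_ [_ Kc _]]] := convex_body_ball bodyK.
have [k Kk Lk] := cov (x + r *: c); exists (k - c); first by exists k => //; exists c.
by move: Lk; congr L; rewrite scalerBr opprB addrA.
Qed.

(** For [r > 0], shifting [K] by an interior point [c] and scaling by [r] gives a set [K'] that
    contains a ball about 0 and whose differences cover modulo [L], as [sum_dilate_covers]
    requires. *)
Lemma covering_radii_of_difference r k : (0 < n)%N -> (4 * n ^ 2 <= 2 ^ k)%N ->
  covering_radii L (difference_body K) r -> covering_radii L K ((4 * k + 5)%:R * r).
Proof.
move=> n0 kn radr; have [r0 cov] := (covering_radiiP _ _).1 radr.
have [c [e [e0 Kc eK]]] := convex_body_ball bodyK.
have [M KM] := convex_body_bounded bodyK; have [_ cK _] := bodyK.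
apply/covering_radiiP; split; first by rewrite mulr_ge0.
(* For [r = 0] the covering hypothesis already puts every point in [L]. *)
have [rE|r_neq0] := eqVneq r 0.
  move=> x; exists c => //; have [d _] := cov x.
  by rewrite rE mulr0 !scale0r.
have {r_neq0}r0 : 0 < r by rewrite lt_def r_neq0.
pose K' := [set r *: (y - c) | y in K].
have cK' : convex_set K'.
  move=> x y t; rewrite !inE => -[a Ka <-] [b Kb <-].
  have := cK a b t; rewrite !inE => /(_ Ka Kb) Kab.
  exists (conv t (a : convex_lmodType _) b) => //; rewrite /conv /=.
  by apply/rowP => i; rewrite !mxE /unstable.onem; ring.
have ballK' x : `|x| <= r * e -> K' x.
  move=> xr; exists (c + r^-1 *: x).
    by apply: eK; rewrite normrZ gtr0_norm ?invr_gt0// ler_pdivrMl.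
  by rewrite [c + _]addrC addrK scalerA divff ?gt_eqF// scale1r.
have K'M x : K' x -> `|x| <= r * (M + `|c|).
  move=> [y Ky <-]; rewrite normrZ gtr0_norm// ler_pM2l//.
  by apply: le_trans (ler_normB _ _) _; rewrite lerD2r KM.
have cov' x : exists a b, [/\ K' a, K' b & L (x - (a - b))].
  have [_ [a Ka [b Kb <-]] Lab] := cov x.
  exists (r *: (a - c)), (r *: (b - c)); split; [by exists a|by exists b|].
  by move: Lab; congr L; rewrite -scalerBr opprB subrKA.
move=> x; set m := (4 * k + 5)%:R.
(* Covering [x - m *: (r *: c)] instead of [x] undoes the shift by [c]. *)
have [_ [_ [y Ky <-] <-] Ly] :=
  sum_dilate_covers n0 latL fullL cK' (mulr_gt0 r0 e0) ballK' K'M cov' kn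
    (x - m *: (r *: c)).
exists y => //; move: Ly; congr L.
by rewrite -addrA -opprD -scalerDr -scalerDr subrKC scalerA.
Qed.

End CoveringRadius.

(** * The logarithmic constant and the conclusion *)

(** With [v] the binary logarithm of [2 * n], minimality of [u] gives [2 ^ u <= 2 * n], so [u <= v];
    as [1 <= v], the factor [13 + 8 * u] is at most [21 * v ^+ 3]. *)
Lemma dilation_factor_le (R : realType) (n : nat) : (0 < n)%N ->
  (4 * (2 + 2 * up_log 2 n) + 5)%:R <= 21 * (ln (2 * n)%:R / ln 2) ^+ 3 :> R.
Proof.
move=> n0; have l0 : 0 < ln 2 :> R by rewrite ln_gt0// ltr1n.
set u := up_log 2 n; set v := _ / _.
have v1 : 1 <= v.
  by rewrite ler_pdivlMr// mul1r ler_ln ?posrE ?ltr0n ?muln_gt0// ler_nat; lia.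
have uv : u%:R <= v.
  rewrite ler_pdivlMr// mulr_natl -lnXn// -natrX ler_ln ?posrE ?ltr0n ?expn_gt0 ?muln_gt0//.
  rewrite ler_nat /u; case: n n0 {u v v1} => [|[|n]] // _.
  have := up_log_gtn (isT : 1 < 2)%N (isT : 1 < n.+2)%N.
  have : (0 < up_log 2 n.+2)%N by rewrite up_log_gt0.
  by case: (up_log 2 n.+2) => // u _ /=; rewrite expnS; lia.
have v3 : v <= v ^+ 3 by rewrite -{1}[v]expr1 ler_weXn2l.
rewrite (_ : (_ + 5)%N = 13 + 8 * u)%N; last by lia.
by rewrite natrD natrM; lra.
Qed.

Theorem theorem7 (R : realType) :
  exists2 C : R, 0 < C &
    forall (n : nat) (L K : set 'rV[R]_n),
      (1 <= n)%N -> lattice L -> full_rank L -> convex_body K ->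
      covering_radius L (difference_body K) <= covering_radius L K /\
      covering_radius L K <=
        C * ln ((2 * n)%:R : R) ^+ 3 * covering_radius L (difference_body K).
Proof.
have l0 : 0 < ln 2 :> R by rewrite ln_gt0// ltr1n.
exists (21 / ln 2 ^+ 3); first by rewrite divr_gt0// exprn_gt0.
move=> n L K n0 latL fullL bodyK.
have [radK minK] := covering_radius_least latL fullL bodyK.
have [radD minD] := covering_radius_least latL fullL (convex_body_difference bodyK).
split; first exact/minD/covering_radii_difference.
(* Here [2 ^ k] equals [4 * (2 ^ up_log 2 n) ^ 2], which is at least [4 * n ^ 2]. *)
pose k := (2 + 2 * up_log 2 n)%N.
have kn : (4 * n ^ 2 <= 2 ^ k)%N.
  by rewrite expnD leq_mul2l mulnC expnM leq_sqr up_logP.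
apply: le_trans (minK _ (covering_radii_of_difference latL fullL bodyK n0 kn radD)) _.
apply: ler_wpM2r; first by case: radD.
by rewrite -mulrA [_^-1 * _]mulrC -expr_div_n; exact: dilation_factor_le.
Qed.
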